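(* Let $G$ be an infinite commutative group, and let $\mu$ be a real-valued functional defined on a subset $\Lambda$ (not necessarily a subspace) of the bounded real functions on $G$. Assume that all constant functions belong to $\Lambda$, and that $\mu(f)=c$ whenever $f\equiv c$ is constant. Suppose that for all $f_1,\dots,f_k\in\Lambda$, $t_1,\dots,t_k\in G$ and $c_1,\dots,c_k\in\mathbb{R}$ such that $$c_1f_1(x+t_1)+\dots+c_kf_k(x+t_k)\ge0\quad\text{for all }x\in G,$$ we have $\sum_{i=1}^k c_i\mu(f_i)\ge0$. Then $\mu$ can be extended to a full mean on $G$.
   Context: $G$ is an infinite commutative (discrete) group, written additively. An upper mean is a functional $\overline M$ assigning a real number to every bounded function $f:G\to\mathbb{R}$ such that: (norming) $\overline M(f)=c$ if $f\equiv c$; (monotonicity) $f\le g$ implies $\overline M(f)\le\overline M(g)$; (homogeneity) $\overline M(cf)=c\overline M(f)$ for every constant $c\ge0$; (restricted additivity) if $t\in G$ and $g(x)=f(x)+f(x+t)$, then $\overline M(g)=2\overline M(f)$; (subadditivity) $\overline M(f+g)\le\overline M(f)+\overline M(g)$. The conjugate lower mean of an upper mean $\overline M$ is $\underline M(f)=-\overline M(-f)$. A functional $M$ defined on a subspace $L$ of the bounded functions is called a mean if there is an upper mean $\overline M$ with conjugate lower mean $\underline M$ such that $\underline M(f)=\overline M(f)$ holds exactly for $f\in L$, and for $f\in L$ this common value is $M(f)$. A mean is full if $L$ consists of all bounded real functions on $G$. *)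

(* Defs.v *)
From HB Require Import structures.
From mathcomp Require Import all_boot all_order all_algebra.
From mathcomp Require Import all_classical all_reals all_analysis.

Set Implicit Arguments.
Unset Strict Implicit.
Unset Printing Implicit Defensive.

Import Order.TTheory GRing.Theory Num.Theory.
Import numFieldNormedType.Exports.

Local Open Scope classical_set_scope.
Local Open Scope ring_scope.

(* A functional on a set [L] of functions is encoded as a total map           *)
(* [(G -> R) -> R] of which only the values on [L] are ever constrained; for  *)
(* upper means [L] is the set [bounded_fun] of all bounded functions.         *)

Record upper_mean (R : realType) (G : zmodType) (U : (G -> R) -> R) : Prop :=
  UpperMean {
    upper_mean_norming : forall c : R, U (cst c) = c ;
    upper_mean_monotone : forall f g : G -> R, bounded_fun f -> bounded_fun g ->
      (forall x : G, f x <= g x) -> U f <= U g ;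
    upper_mean_homogeneous : forall (c : R) (f : G -> R), 0 <= c ->
      bounded_fun f -> U (fun x => c * f x) = c * U f ;
    upper_mean_restricted_additive : forall (t : G) (f : G -> R),
      bounded_fun f -> U (fun x => f x + f (x + t)) = 2 * U f ;
    upper_mean_subadditive : forall f g : G -> R,
      bounded_fun f -> bounded_fun g -> U (fun x => f x + g x) <= U f + U g
  }.

Definition lower_mean (R : realType) (G : zmodType) (U : (G -> R) -> R)
    (f : G -> R) : R :=
  - U (fun x => - f x).

Definition mean (R : realType) (G : zmodType) (L : set (G -> R))
    (M : (G -> R) -> R) : Prop :=
  [/\ L `<=` bounded_fun,
      submod_closed (mem L : {pred (G -> R)}) &
      exists U : (G -> R) -> R,
        [/\ upper_mean U,
            forall f : G -> R, bounded_fun f -> (lower_mean U f = U f <-> L f) &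
            forall f : G -> R, L f -> M f = U f]].

Definition full_mean (R : realType) (G : zmodType) (M : (G -> R) -> R) : Prop :=
  mean bounded_fun M.

(* Main.v *)
Require Import Defs.
From HB Require Import structures.
From mathcomp Require Import all_boot all_order all_algebra.
From mathcomp Require Import all_classical all_reals all_analysis.
From mathcomp Require Import lra.

Set Implicit Arguments.
Unset Strict Implicit.
Unset Printing Implicit Defensive.

Import Order.TTheory GRing.Theory Num.Theory.
Import numFieldNormedType.Exports.

Local Open Scope classical_set_scope.
Local Open Scope ring_scope.

(* For bounded [f], let [p f] be the infimum of the [m] such that some finite
   average of translates of [f] lies below a linear combination
   [F = sum c_i f_i(x + t_i)] of translates of elements of [Lambda], where
   [m = sum c_i mu(f_i)]. Positivity of [mu] makes [p] finite, and averaging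
   over sums of two finite sets makes it sublinear. Take a linear [phi <= p] by
   Hahn-Banach. It is positive because [p f <= 0] for [f <= 0]; it extends [mu]
   because [p f <= mu f] and [p (- f) <= - mu f] on [Lambda]; and it is
   invariant because averaging over [0, t, ..., (n - 1) t] telescopes, whence
   [p (f(x + t) - f(x)) <= 2 sup|f| / n] for every [n]. *)

(** * Sublinear functionals and the Hahn-Banach theorem *)

Definition sublinear (R : realType) (V : lmodType R) (p : V -> R) : Prop :=
  (forall x y, p (x + y) <= p x + p y) /\
  (forall c x, 0 < c -> p (c *: x) <= c * p x).

Lemma sublinear0 (R : realType) (V : lmodType R) (p : V -> R) :
  sublinear p -> p 0 = 0.
Proof.
move=> [_ pZ]; have := pZ 2 0; have := pZ 2^-1 0; rewrite !scaler0.
by move=> /(_ ltac:(lra)) ? /(_ ltac:(lra)) ?; lra.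
Qed.

(** The inequality for [c^-1] at [c *: x] is the converse of the one for [c] at [x]. This is why one
    direction is enough in [sublinear], and one direction passes easily to infima. *)
Lemma sublinearZ (R : realType) (V : lmodType R) (p : V -> R) c x :
  sublinear p -> 0 <= c -> p (c *: x) = c * p x.
Proof.
move=> sp; rewrite le_eqVlt => /predU1P[<-|c0].
  by rewrite scale0r mul0r sublinear0.
case: sp => _ pZ; apply/eqP; rewrite eq_le pZ//=.
have ci : 0 < c^-1 by rewrite invr_gt0.
have := pZ _ (c *: x) ci; rewrite scalerA mulVf ?gt_eqF// scale1r.
by rewrite mulrC ler_pdivlMr// mulrC.
Qed.

Lemma sublinear_opp (R : realType) (V : lmodType R) (p : V -> R) x :
  sublinear p -> - p (- x) <= p x.
Proof.
move=> sp; have := sp.1 x (- x); rewrite subrr (sublinear0 sp); lra.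
Qed.

(** Serves three times: for chains in Zorn's lemma, for the perturbations of a minimal functional,
    and for [p] itself. *)
Lemma sublinear_inf (R : realType) (V : lmodType R) (S : V -> set R) :
  (forall x, S x !=set0) -> (forall x, has_lbound (S x)) ->
  (forall x y a b, S x a -> S y b -> exists2 d, S (x + y) d & d <= a + b) ->
  (forall c x a, 0 < c -> S x a -> exists2 d, S (c *: x) d & d <= c * a) ->
  sublinear (fun x => inf (S x)).
Proof.
move=> S0 Slb SD SZ; split=> [x y|c x c0].
  rewrite -lerBlDr; apply: lb_le_inf => // a Sa.
  rewrite lerBlDr -lerBlDl; apply: lb_le_inf => // b Sb.
  rewrite lerBlDl; have [d Sd] := SD _ _ _ _ Sa Sb.
  by apply: le_trans; exact: ge_inf.
rewrite mulrC -ler_pdivrMr//; apply: lb_le_inf => // a Sa.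
rewrite ler_pdivrMr// mulrC; have [d Sd] := SZ _ _ _ c0 Sa.
by apply: le_trans; exact: ge_inf.
Qed.

(** Zorn's lemma applies because a nonempty chain is bounded by its pointwise infimum, which is
    finite: [- p (- x)] lies below every member at [x]. *)
Lemma minimal_sublinear (R : realType) (V : lmodType R) (p : V -> R) :
  sublinear p -> exists q : V -> R,
    [/\ sublinear q, forall x, q x <= p x &
      forall r, sublinear r -> (forall x, r x <= q x) -> r = q].
Proof.
move=> sp.
pose T := {q : V -> R | sublinear q /\ forall x, q x <= p x}.
pose mkT q sq qp : T := exist _ q (conj sq qp).
(* The order is reversed, so a maximal element is a minimal functional. *)
pose le (q r : T) := `[< forall x, sval r x <= sval q x >].
have [||||q qmin] := @Zorn T le.
- by move=> q; apply/asboolP.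
- move=> q r s /asboolP qr /asboolP rs; apply/asboolP => x.
  exact: le_trans (rs x) (qr x).
- move=> q r /asboolP qr /asboolP rq; apply: eq_sig_hprop => [? ? ?|].
    exact: Prop_irrelevance.
  apply/funext => x.
  by apply/eqP; rewrite eq_le rq qr.
- move=> A Atot; have [[q0 Aq0]|A0] := pselect (A !=set0); last first.
    exists (mkT p sp (fun=> lexx _)) => s As.
    by exfalso; apply: A0; exists s.
  pose S x := [set sval q x | q in A].
  have Slb x : has_lbound (S x).
    exists (- p (- x)) => _ [[q [sq qp]] _ <-] /=.
    by apply: le_trans (sublinear_opp x sq); rewrite lerN2.
  have SA q x : A q -> inf (S x) <= sval q x.
    by move=> Aq; apply: ge_inf => //; exists q.
  suff sS : sublinear (fun x => inf (S x)).
    have Sp x : inf (S x) <= p x.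
      exact: le_trans (SA _ _ Aq0) ((svalP q0).2 x).
    exists (mkT _ sS Sp) => q Aq; apply/asboolP => x /=; exact: SA.
  apply: sublinear_inf => //.
  + by move=> x; exists (sval q0 x); exists q0.
  + move=> x y _ _ [q Aq <-] [r Ar <-].
    (* The smaller of the two chain members serves for both summands. *)
    have [/asboolP h|/asboolP h] := Atot _ _ Aq Ar.
      exists (sval r (x + y)); first by exists r.
      by apply: le_trans ((svalP r).1.1 x y) _; rewrite lerD2r.
    exists (sval q (x + y)); first by exists q.
    by apply: le_trans ((svalP q).1.1 x y) _; rewrite lerD2l.
  + move=> c x _ c0 [q Aq <-]; exists (sval q (c *: x)); first by exists q.
    exact: (svalP q).1.2.
exists (sval q); case: (svalP q) => sq qp; split=> // r sr rq.
have rp x : r x <= p x by apply: le_trans (rq x) (qp x).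
rewrite -(qmin (mkT r sr rp))//; exact/asboolP.
Qed.

(* A minimal sublinear [q] equals [x |-> inf_(t >= 0) (q (x + t y) - t q y)];
   taking [t = 1] gives superadditivity. *)
Lemma hahn_banach (R : realType) (V : lmodType R) (p : V -> R) :
  sublinear p -> exists phi : V -> R,
    [/\ forall x y, phi (x + y) = phi x + phi y,
        forall c x, phi (c *: x) = c * phi x &
        forall x, phi x <= p x].
Proof.
move=> sp; have [q [sq qp qmin]] := minimal_sublinear sp.
have qD x y : q (x + y) = q x + q y.
  apply/eqP; rewrite eq_le sq.1/= -lerBrDr.
  pose S z := [set q (z + t *: y) - t * q y | t in [set t | 0 <= t]].
  have Slb z : has_lbound (S z).
    exists (- q (- z)) => _ [t t0 <-]; rewrite -(sublinearZ _ sq)//.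
    (* Subadditivity is applied to [t *: y = (z + t *: y) + (- z)]. *)
    rewrite lerBrDl lerBlDr.
    by apply: le_trans (sq.1 _ _); rewrite addrAC subrr add0r.
  rewrite -[X in X x <= _](qmin (fun z => inf (S z))).
  - by apply: ge_inf => //; exists 1 => /=; rewrite ?scale1r ?mul1r.
  - apply: sublinear_inf => //.
    + by move=> z; exists (q (z + 0 *: y) - 0 * q y); exists 0 => /=.
    + move=> u v _ _ [s /= s0 <-] [t /= t0 <-].
      exists (q (u + v + (s + t) *: y) - (s + t) * q y).
        by exists (s + t) => //=; exact: addr_ge0.
      have := sq.1 (u + s *: y) (v + t *: y).
      by rewrite addrACA -scalerDl; lra.
    + move=> c u _ c0 [s /= s0 <-].
      exists (q (c *: u + (c * s) *: y) - (c * s) * q y).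
        by exists (c * s) => //=; rewrite mulr_ge0// ltW.
      by rewrite -scalerA -scalerDr (sublinearZ _ sq (ltW c0)) mulrBr mulrA.
  - move=> z; apply: ge_inf => //.
    by exists 0 => //=; rewrite scale0r mul0r subr0 addr0.
have qN x : q (- x) = - q x.
  by have := qD x (- x); rewrite subrr (sublinear0 sq); lra.
exists q; split=> // c x.
have [c0|c0] := leP 0 c; first exact: sublinearZ.
rewrite -[c]opprK scaleNr qN (sublinearZ _ sq) ?mulNr//.
by rewrite oppr_ge0 ltW.
Qed.

(** * The vector space of bounded functions *)

Lemma bounded_funP (R : realType) (T : Type) (f : T -> R) :
  bounded_fun f <-> exists B : R, forall x, `|f x| <= B.
Proof.
split=> [[M [_ hM]]|[B hB]].
  by exists (M + 1) => x; apply: (hM (M + 1)) => //; rewrite ltrDl.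
exists B; split; first exact: num_real.
by move=> M BM x _; exact: le_trans (hB x) (ltW BM).
Qed.

Lemma bounded_fun_submod (R : realType) (T : Type) :
  submod_closed (mem bounded_fun : {pred (T -> R)}).
Proof.
split; first by rewrite inE; apply/bounded_funP; exists 0 => x; rewrite normr0.
move=> c f g; rewrite !inE => /bounded_funP[A hA] /bounded_funP[B hB].
apply/bounded_funP; exists (`|c| * A + B) => x.
apply: le_trans (ler_normD _ _) _; rewrite lerD// normrM ler_wpM2l//.
Qed.

Definition bounded_pred (R : realType) (T : Type) : {pred (T -> R)} :=
  mem bounded_fun.

HB.instance Definition _ (R : realType) (T : Type) :=
  GRing.isSubmodClosed.Build R (T -> R) (@bounded_pred R T)
    (@bounded_fun_submod R T).

Definition bfun (R : realType) (T : Type) :=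
  {f : T -> R | f \in @bounded_pred R T}.

HB.instance Definition _ (R : realType) (T : Type) :=
  SubChoice.on (bfun R T).
HB.instance Definition _ (R : realType) (T : Type) :=
  [SubChoice_isSubLmodule of bfun R T by <:].

(** * Combinations and averages of translates *)

Definition translate_span (R : realType) (G : zmodType) (Lambda : set (G -> R))
    (mu : (G -> R) -> R) (F : G -> R) (m : R) : Prop :=
  exists (I : finType) (f : I -> G -> R) (t : I -> G) (c : I -> R),
    [/\ forall i, Lambda (f i),
        forall x, F x = \sum_i c i * f i (x + t i) &
        m = \sum_i c i * mu (f i)].

Lemma translate_span_gen (R : realType) (G : zmodType) (Lambda : set (G -> R))
    (mu : (G -> R) -> R) (f : G -> R) :
  Lambda f -> translate_span Lambda mu f (mu f).
Proof.
move=> Lf; exists unit, (fun=> f), (fun=> 0), (fun=> 1).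
split=> // [x|]; rewrite (big_pred1 tt) ?mul1r ?addr0//; by case.
Qed.

Lemma translate_spanZD (R : realType) (G : zmodType) (Lambda : set (G -> R))
    (mu : (G -> R) -> R) (c : R) (F F' : G -> R) (m m' : R) :
  translate_span Lambda mu F m -> translate_span Lambda mu F' m' ->
  translate_span Lambda mu (fun x => c * F x + F' x) (c * m + m').
Proof.
move=> [I [f [t [a [Lf Fe ->]]]]] [J [g [u [b [Lg Ge ->]]]]].
exists (I + J)%type,
  (fun k => match k with inl i => f i | inr j => g j end),
  (fun k => match k with inl i => t i | inr j => u j end),
  (fun k => match k with inl i => c * a i | inr j => b j end).
split=> [[]//|x|]; rewrite big_sumType/= ?Fe ?Ge mulr_sumr; congr (_ + _);
  by apply: eq_bigr => i _; rewrite mulrA.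
Qed.

Lemma translate_span_shift (R : realType) (G : zmodType) (Lambda : set (G -> R))
    (mu : (G -> R) -> R) (t : G) (F : G -> R) (m : R) :
  translate_span Lambda mu F m ->
  translate_span Lambda mu (fun x => F (x + t)) m.
Proof.
move=> [I [f [u [a [Lf Fe ->]]]]]; exists I, f, (fun i => t + u i), a.
by split=> // x; rewrite Fe; apply: eq_bigr => i _; rewrite addrA.
Qed.

Lemma translate_spanZ (R : realType) (G : zmodType) (Lambda : set (G -> R))
    (mu : (G -> R) -> R) (c : R) (F : G -> R) (m : R) :
  translate_span Lambda mu F m ->
  translate_span Lambda mu (fun x => c * F x) (c * m).
Proof.
move=> [I [f [t [a [Lf Fe ->]]]]]; exists I, f, t, (fun i => c * a i).
by split=> // [x|]; rewrite ?Fe mulr_sumr; apply: eq_bigr => i _; rewrite mulrA.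
Qed.

(** A translate keeps the value [m], hence so does an average of translates. *)
Lemma translate_span_average (R : realType) (G : zmodType)
    (Lambda : set (G -> R)) (mu : (G -> R) -> R) (s : seq G) (F : G -> R)
    (m : R) : s != [::] ->
  translate_span Lambda mu F m ->
  translate_span Lambda mu
    (fun x => (size s)%:R^-1 * \sum_(t <- s) F (x + t)) m.
Proof.
move=> s0 FS; have sz : (size s)%:R != 0 :> R by rewrite pnatr_eq0 size_eq0.
(* Cancelling the factor leaves the plain sum, of value [(size s)%:R * m], to the induction on [s].
   The empty sum is treated as [0] times [F]. *)
rewrite -[m](mulKf sz); apply: translate_spanZ; elim: s {s0 sz} => [|t s IH].
  have := translate_spanZ 0 FS; rewrite !mul0r; congr translate_span.
  by apply/funext => x; rewrite big_nil mul0r.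
have := translate_spanZD 1 (translate_span_shift t FS) IH.
rewrite mul1r /= -[(size s).+1%:R]natr1 [_ + 1]addrC mulrDl mul1r.
by congr translate_span; apply/funext => x; rewrite big_cons mul1r.
Qed.

(** The infimum of this set is [p f]. Averages run over sequences, so translates count with
    multiplicity; the inequality is multiplied by the length. *)
Definition average_bound (R : realType) (G : zmodType) (Lambda : set (G -> R))
    (mu : (G -> R) -> R) (f : G -> R) : set R :=
  [set m | exists s F, [/\ s != [::], translate_span Lambda mu F m &
    forall x : G, \sum_(t <- s) f (x + t) <= (size s)%:R * F x]].

(** Averaging the first bound over [s'] and the second over [s] turns both into bounds for averages
    over the sums [t + u]. Commutativity of [G] lets either shift be made first. *)
Lemma average_boundD (R : realType) (G : zmodType) (Lambda : set (G -> R))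
    (mu : (G -> R) -> R) (f g : G -> R) (a b : R) :
  average_bound Lambda mu f a -> average_bound Lambda mu g b ->
  average_bound Lambda mu (fun x => f x + g x) (a + b).
Proof.
move=> [s [F [s0 FS fF]]] [s' [F' [s'0 FS' gF]]].
(* Repetitions are kept, so the length is the product of the two lengths. *)
pose r := [seq t + u | t <- s, u <- s'].
have sz : (size s)%:R != 0 :> R by rewrite pnatr_eq0 size_eq0.
have sz' : (size s')%:R != 0 :> R by rewrite pnatr_eq0 size_eq0.
have H := translate_spanZD 1 (translate_span_average s'0 FS)
  (translate_span_average s0 FS').
rewrite mul1r in H; exists r; eexists; split; [|exact: H|] => [|x].
  by rewrite -size_eq0 size_allpairs muln_eq0 !size_eq0 negb_or s0.
rewrite big_split/= size_allpairs natrM mul1r mulrDr; apply: lerD.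
  rewrite -mulrA mulVKf// mulr_sumr big_allpairs_dep exchange_big/=.
  apply: ler_sum => u _; apply: le_trans (fF (x + u)).
  rewrite le_eqVlt; apply/orP; left; apply/eqP/eq_bigr => t _.
  by rewrite addrA addrAC.
rewrite [_%:R * _%:R]mulrC -mulrA mulVKf// mulr_sumr big_allpairs_dep/=.
apply: ler_sum => t _; apply: le_trans (gF (x + t)).
rewrite le_eqVlt; apply/orP; left; apply/eqP/eq_bigr => u _.
by rewrite addrA.
Qed.

Lemma average_boundZ (R : realType) (G : zmodType) (Lambda : set (G -> R))
    (mu : (G -> R) -> R) (c : R) (f : G -> R) (a : R) : 0 <= c ->
  average_bound Lambda mu f a ->
  average_bound Lambda mu (fun x => c * f x) (c * a).
Proof.
move=> c0 [s [F [s0 FS fF]]]; exists s, (fun x => c * F x).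
split=> // [|x]; first exact: translate_spanZ.
by rewrite -mulr_sumr mulrCA ler_wpM2l.
Qed.

Lemma average_bound_span (R : realType) (G : zmodType) (Lambda : set (G -> R))
    (mu : (G -> R) -> R) (f F : G -> R) (m : R) :
  (forall x, f x <= F x) -> translate_span Lambda mu F m ->
  average_bound Lambda mu f m.
Proof.
move=> fF FS; exists [:: 0], F; split=> // x.
by rewrite big_seq1 addr0 mul1r.
Qed.

Lemma average_bound_translation (R : realType) (G : zmodType)
    (Lambda : set (G -> R)) (mu : (G -> R) -> R) (f : G -> R) (t : G) (B : R)
    (n : nat) :
  Lambda (cst (2 * B / n.+1%:R)) ->
  (forall x, `|f x| <= B) ->
  average_bound Lambda mu (fun x => f (x + t) - f x)
    (mu (cst (2 * B / n.+1%:R))).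
Proof.
(* Elements repeat if [t] has small order, but the sum over the [n.+1] indices still telescopes. *)
move=> Lc fB; exists [seq t *+ i | i <- iota 0 n.+1], (cst (2 * B / n.+1%:R)).
split=> // [|x]; first exact: translate_span_gen.
rewrite size_map size_iota mulrC divfK ?pnatr_eq0// big_map.
have -> : \sum_(i <- iota 0 n.+1) (f (x + t *+ i + t) - f (x + t *+ i)) =
    f (x + t *+ n.+1) - f x.
  have := telescope_sumr (fun i => f (x + t *+ i)) (leq0n n.+1).
  rewrite /= mulr0n addr0 => <-.
  by apply: eq_bigr => i _; rewrite mulrSr addrA.
have := fB x; have := fB (x + t *+ n.+1); rewrite !ler_norml.
by move=> /andP[_ ?] /andP[? _]; lra.
Qed.

(** * Construction of the full mean *)

Theorem theorem8p1 (R : realType) (G : zmodType)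
  (G_infinite : infinite_set [set: G])
  (Lambda : set (G -> R)) (mu : (G -> R) -> R)
  (Lambda_bounded : Lambda `<=` bounded_fun)
  (Lambda_cst : forall c : R, Lambda (cst c))
  (mu_cst : forall c : R, mu (cst c) = c)
  (mu_pos : forall (k : nat) (f : 'I_k -> G -> R) (t : 'I_k -> G)
      (c : 'I_k -> R),
    (forall i : 'I_k, Lambda (f i)) ->
    (forall x : G, 0 <= \sum_(i < k) c i * f i (x + t i)) ->
    0 <= \sum_(i < k) c i * mu (f i)) :
  exists M : (G -> R) -> R,
    full_mean M /\ (forall f : G -> R, Lambda f -> M f = mu f).
Proof.
have span_cst c : translate_span Lambda mu (cst c) c.
  by rewrite -{2}(mu_cst c); exact: translate_span_gen.
have span_pos F m : translate_span Lambda mu F m ->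
    (forall x, 0 <= F x) -> 0 <= m.
  move=> [I [f [t [c [Lf Fe ->]]]]] F0.
  (* Positivity is assumed for ordinal indices, so [I] is enumerated. *)
  rewrite big_enum_val/=.
  apply: (mu_pos _ (fun i => f (enum_val i)) (fun i => t (enum_val i))) => // x.
  by have := F0 x; rewrite Fe big_enum_val.
pose S (f : bfun R G) := average_bound Lambda mu (val f).
have valB (f : bfun R G) : exists B : R, forall x, `|val f x| <= B.
  by apply/bounded_funP; have := valP f; rewrite inE.
have Slb f : has_lbound (S f).
  have [B fB] := valB f; exists (- B) => m [s [F [s0 FS fF]]].
  (* This is the value of [F + B], which is nonnegative because averages of [f] are at least
     [- B]. *)
  suff : 0 <= 1 * m + B by lra.
  apply: span_pos (translate_spanZD 1 FS (span_cst B)) _ => x /=.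
  suff : - B <= F x by lra.
  have sz : 0 < (size s)%:R :> R by rewrite ltr0n lt0n size_eq0.
  rewrite -(ler_pM2l sz); apply: le_trans (fF x).
  rewrite mulr_natl -[_ *+ _]iter_addr_0 -[size s]count_predT -big_const_seq.
  apply: ler_sum => t _.
  by have := fB (x + t); rewrite ler_norml => /andP[].
have sS : sublinear (fun f => inf (S f)).
  apply: sublinear_inf.
  - move=> f; have [B fB] := valB f; exists B.
    apply: (average_bound_span (F := cst B)) => // x.
    exact: le_trans (ler_norm _) (fB x).
  - exact: Slb.
  - by move=> f g a b Sf Sg; exists (a + b) => //; exact: average_boundD.
  - by move=> c f a /ltW c0 Sf; exists (c * a) => //; exact: average_boundZ.
have [phi [phiD phiZ phiS]] := hahn_banach sS.
have phi_le (f : bfun R G) m : S f m -> phi f <= m.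
  by move=> Sm; apply: le_trans (phiS f) _; exact: ge_inf.
have phiN f : phi (- f) = - phi f by rewrite -scaleN1r phiZ mulN1r.
have phi_le0 (f : bfun R G) : (forall x, val f x <= 0) -> phi f <= 0.
  by move=> f0; apply: phi_le; exact: average_bound_span (span_cst 0).
have phi_mono (f g : bfun R G) : (forall x, val f x <= val g x) ->
    phi f <= phi g.
  move=> fg; rewrite -subr_le0 -phiN -phiD; apply: phi_le0 => x.
  by rewrite raddfB/= subr_le0; exact: fg.
have phi_translate_le (f g : bfun R G) t :
    (forall x, val g x = val f (x + t)) -> phi g <= phi f.
  move=> gE; have [B fB] := valB f; rewrite -subr_le0 -phiN -phiD.
  have B0 : 0 <= B by apply: le_trans (fB 0).
  apply/ler_addgt0Pl => e e0.
  (* Chosen so that [2 * B / n.+1%:R < e]. *)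
  pose n := Num.truncn (2 * B / e).
  apply: le_trans (phi_le _ (mu (cst (2 * B / n.+1%:R))) _) _.
    have := average_bound_translation mu t (Lambda_cst (2 * B / n.+1%:R)) fB.
    by congr average_bound; apply/funext => x; rewrite raddfB/= -gE.
  rewrite mu_cst addr0 ler_pdivrMr ?ltr0n// [e * _]mulrC -ler_pdivrMr//.
  by apply: ltW; exact: truncnS_gt.
have phi_translate (f g : bfun R G) t : (forall x, val g x = val f (x + t)) ->
    phi g = phi f.
  move=> gE; apply/eqP; rewrite eq_le (phi_translate_le _ _ _ gE)/=.
  (* Translating [g] by [- t] gives back [f]. *)
  by apply: (@phi_translate_le _ _ (- t)) => x; rewrite gE subrK.
have phi_mu (f : bfun R G) : Lambda (val f) -> phi f = mu (val f).
  move=> Lf; have Sf := translate_span_gen mu Lf.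
  apply/eqP; rewrite eq_le phi_le/=; last exact: average_bound_span Sf.
  rewrite -lerN2 -phiN -mulN1r; apply: phi_le.
  apply: average_bound_span (translate_spanZ _ Sf) => x.
  by rewrite raddfN mulN1r.
have Bin (f : G -> R) : bounded_fun f -> f \in @bounded_pred R G by rewrite inE.
(* Unbounded functions are sent to [0]; the axioms of a mean concern bounded ones only. *)
pose tob (f : G -> R) : bfun R G := insubd 0 f.
have tobK f : bounded_fun f -> val (tob f) = f.
  by move=> /Bin fB; rewrite insubdK.
exists (phi \o tob); split; last first.
  by move=> f Lf; have fB := Lambda_bounded _ Lf; rewrite /= phi_mu tobK.
have tobE f g : val f = g -> tob g = f by move=> <-; exact: valKd.
split; [exact: subset_refl|exact: bounded_fun_submod|].
have U_N f : bounded_fun f -> phi (tob (fun x => - f x)) = - phi (tob f).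
  move=> fB; rewrite -phiN; congr phi; apply: tobE.
  by rewrite raddfN/= tobK.
have U_D f g : bounded_fun f -> bounded_fun g ->
    phi (tob (fun x => f x + g x)) = phi (tob f) + phi (tob g).
  move=> fB gB; rewrite -phiD; congr phi.
  by apply: tobE; rewrite raddfD/= !tobK.
(* The linear functional is its own upper mean: by [U_N] its lower mean agrees with it on every
   bounded function. *)
exists (phi \o tob); split=> //; last first.
  by move=> f fB; split=> // _; rewrite /lower_mean/= U_N// opprK.
split=> /=.
- move=> c; have cB := Lambda_bounded _ (Lambda_cst c).
  by rewrite phi_mu tobK.
- by move=> f g fB gB fg; apply: phi_mono => x; rewrite !tobK.
- move=> c f c0 fB; rewrite -phiZ; congr phi; apply: tobE.
  by rewrite linearZ/= tobK.
- move=> t f fB.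
  have ftB : bounded_fun (fun x => f (x + t)).
    by move/bounded_funP : fB => [B fB]; apply/bounded_funP; exists B.
  (* Restricted additivity follows from additivity and translation invariance. *)
  rewrite U_D// (phi_translate (tob f) (tob (fun x => f (x + t))) t).
    by rewrite mulr_natl.
  by move=> x; rewrite !tobK.
- by move=> f g fB gB; rewrite U_D.
Qed.
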